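(* Let $p$ be a prime, $m,n\ge 2$ integers and $a,b,c,d,e,f,g,h\in\mathbb{Z}_p$. Let $T_{\mathrm R}^{\phi_{180^\circ}}\in \mathbf{M}_{mn\times mn}(\mathbb{Z}_p)$ be the rule matrix of the finite two-dimensional linear Moore cellular automaton on an $m\times n$ grid with coefficients $a,\dots,h$ under the mixed boundary condition $\phi_{180^\circ}$ (null on the bottom and right, reflexive on the top and left). Then $T_{\mathrm R}^{\phi_{180^\circ}}$ is the $m\times m$ block matrix with $n\times n$ blocks $$T_{\mathrm R}^{\phi_{180^\circ}}=\begin{pmatrix} A_3 & D_3 & O & O &\dots & O & O & O\\ C_3 & A_3 & B_3 & O & \dots & O & O & O\\ O & C_3 & A_3 & B_3 &\dots & O & O & O\\ \vdots & \vdots & \vdots & \vdots &\ddots &\vdots & \vdots & \vdots\\ O & O & O & O & \dots & C_3 & A_3 & B_3\\ O & O & O & O & \dots & O & C_3 & A_3 \end{pmatrix},$$ where $A_3=A+h\,\epsilon_{1,2}$, $B_3=B+g\,\epsilon_{1,2}$, $C_3=C+a\,\epsilon_{1,2}$ and $D_3=B+C+(a+g)\,\epsilon_{1,2}+c\,\epsilon_{n,n-1}$.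
   Context: Cellular automaton. A configuration is a matrix $(x_{i,j})_{1\le i\le m,\,1\le j\le n}$ over the field $\mathbb{Z}_p$. One time step replaces every $x_{i,j}$ simultaneously by $$a x_{i-1,j-1}+b x_{i-1,j}+c x_{i-1,j+1}+d x_{i,j+1}+e x_{i+1,j+1}+f x_{i+1,j}+g x_{i+1,j-1}+h x_{i,j-1}\pmod p,$$ where values at cells outside the grid (row index $0$ or $m+1$, or column index $0$ or $n+1$) are prescribed by the boundary condition. Boundary condition $\phi_{180^\circ}$: $x_{m+1,l}=0$ for $0\le l\le n+1$; $x_{k,n+1}=0$ for $1\le k\le m+1$; $x_{k,0}=x_{k,2}$ for $1\le k\le m$; $x_{0,l}=x_{2,l}$ for $1\le l\le n$; $x_{0,0}=x_{2,2}$; $x_{0,n+1}=x_{2,n-1}$. Rule matrix. Identify a configuration with the column vector $X=(x_{11},\dots,x_{1n},\dots,x_{m1},\dots,x_{mn})^T\in\mathbb{Z}_p^{mn}$. The rule matrix is the matrix $T$ such that $X^{(t+1)}=T X^{(t)}$ for every configuration $X^{(t)}$ with successor $X^{(t+1)}$. Notation. All blocks are $n\times n$ over $\mathbb{Z}_p$. $P$ has ones on the first superdiagonal and zeros elsewhere; $Q=P^T$ has ones on the first subdiagonal; $I$ is the identity; $O$ is the zero matrix; $\epsilon_{k,l}$ is the matrix unit with a single $1$ in position $(k,l)$. $A=dP+hQ$, $B=fI+eP+gQ$, $C=bI+cP+aQ$. In the block matrix all diagonal blocks are $A_3$; all subdiagonal blocks are $C_3$; the superdiagonal blocks are $B_3$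 except the first one, in block position $(1,2)$, which is $D_3$; all other blocks are $O$. *)

(* Defs.v *)
From mathcomp Require Import all_boot all_order all_algebra.

Set Implicit Arguments.
Unset Strict Implicit.
Unset Printing Implicit Defensive.

Import GRing.Theory.
Local Open Scope ring_scope.

(* A configuration is x : 'M_(m, n). A padded configuration y : nat -> nat -> R
   uses 1-based cell coordinates, so y k l is meaningful for 0 <= k <= m.+1 and
   0 <= l <= n.+1, and the cell x_{k,l} of the grid is x i j with k = i.+1 and
   l = j.+1. *)

Definition pads (R : Type) (m n : nat) (x : 'M[R]_(m, n))
    (y : nat -> nat -> R) : Prop :=
  forall (i : 'I_m) (j : 'I_n), y i.+1 j.+1 = x i j.

Record phi180 (R : pzRingType) (m n : nat) (y : nat -> nat -> R) : Prop := {
  phi180_bottom : forall l, (0 <= l <= n.+1)%N -> y m.+1 l = 0;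
  phi180_right : forall k, (1 <= k <= m.+1)%N -> y k n.+1 = 0;
  phi180_left : forall k, (1 <= k <= m)%N -> y k 0 = y k 2;
  phi180_top : forall l, (1 <= l <= n)%N -> y 0 l = y 2 l;
  phi180_top_left : y 0 0 = y 2 2;
  phi180_top_right : y 0 n.+1 = y 2 n.-1
}.

(* Used only at cells of the grid (k, l >= 1), where .-1 does not truncate. *)
Definition moore_rule (R : pzRingType) (a b c d e f g h : R)
    (y : nat -> nat -> R) (k l : nat) : R :=
  a * y k.-1 l.-1 + b * y k.-1 l + c * y k.-1 l.+1 + d * y k l.+1 +
  e * y k.+1 l.+1 + f * y k.+1 l + g * y k.+1 l.-1 + h * y k l.-1.

Definition successor180 (R : pzRingType) (m n : nat) (a b c d e f g h : R)
    (x x' : 'M[R]_(m, n)) : Prop :=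
  exists y : nat -> nat -> R,
    [/\ pads x y, phi180 m n y &
        forall (i : 'I_m) (j : 'I_n),
          x' i j = moore_rule a b c d e f g h y i.+1 j.+1].

Definition config_vec (R : Type) (m n : nat) (x : 'M[R]_(m, n)) :
    'cV[R]_(m * n) := (mxvec x)^T.

(* mxvec is row-major: x_{k,l} is entry (k - 1) n + l of the column vector. *)
Lemma mxvec_index_val (m n : nat) (i : 'I_m) (j : 'I_n) :
  mxvec_index i j = (i * n + j)%N :> nat.
Proof.
have idx (S T : eqType) (x : S) (y : T) s t : x \in s -> y \in t ->
    index (x, y) [seq (u, v) | u <- s, v <- t] =
    (index x s * size t + index y t)%N.
  elim: s => //= z s IHs; rewrite inE index_cat size_map => + yt.
  case: (eqVneq z x) => [-> _ | zx].
    by rewrite map_f // index_map // => ? ? [].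
  rewrite /= => xs.
  case: mapP => [[v _ [xz]] | _]; first by rewrite xz eqxx in zx.
  by rewrite IHs // mulSn addnA.
have rankE (T : finType) (x : T) : enum_rank x = index x (enum T) :> nat.
  rewrite -[x in RHS]enum_rankK /enum_val index_uniq ?enum_uniq //.
  by rewrite -cardE ltn_ord.
rewrite /mxvec_index /= rankE enumT unlock /= /prod_enum idx ?mem_enum //.
by rewrite size_enum_ord !index_enum_ord.
Qed.

Definition is_rule_matrix180 (R : pzRingType) (m n : nat)
    (a b c d e f g h : R) (T : 'M[R]_(m * n)) : Prop :=
  forall x x' : 'M[R]_(m, n), successor180 a b c d e f g h x x' ->
    config_vec x' = T *m config_vec x.

Section Blocks.

Context (R : pzRingType) (n : nat).

Definition Pmx : 'M[R]_n := \matrix_(i, j) (j == i.+1 :> nat)%:R.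
Definition Qmx : 'M[R]_n := Pmx^T.

(* The matrix unit, with 1-based position (k, l). *)
Definition munit (k l : nat) : 'M[R]_n :=
  \matrix_(i, j) ((i.+1 == k) && (j.+1 == l))%:R.

Lemma munitE (i j : 'I_n) : munit i.+1 j.+1 = delta_mx i j.
Proof. by apply/matrixP=> r s; rewrite !mxE !eqSS. Qed.

Definition Amx (d h : R) : 'M[R]_n := d *: Pmx + h *: Qmx.
Definition Bmx (e f g : R) : 'M[R]_n := f%:M + e *: Pmx + g *: Qmx.
Definition Cmx (a b c : R) : 'M[R]_n := b%:M + c *: Pmx + a *: Qmx.

Definition A3 (d h : R) : 'M[R]_n := Amx d h + h *: munit 1 2.
Definition B3 (e f g : R) : 'M[R]_n := Bmx e f g + g *: munit 1 2.
Definition C3 (a b c : R) : 'M[R]_n := Cmx a b c + a *: munit 1 2.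
Definition D3 (a b c e f g : R) : 'M[R]_n :=
  Bmx e f g + Cmx a b c + (a + g) *: munit 1 2 + c *: munit n n.-1.

End Blocks.

(* Block indices are 0-based: D3 sits in block row 0, block column 1. *)
Definition block180 (R : pzRingType) (m n : nat) (a b c d e f g h : R)
    (i j : 'I_m) : 'M[R]_n :=
  if i == j then A3 n d h
  else if i == j.+1 :> nat then C3 n a b c
  else if j == i.+1 :> nat then
    if i == 0 :> nat then D3 n a b c e f g else B3 n e f g
  else 0.

Lemma sum_ord_const (m n : nat) : (\sum_(i < m) n)%N = (m * n)%N.
Proof. by rewrite sum_nat_const card_ord. Qed.

Definition blockmx180 (R : pzRingType) (m n : nat) (a b c d e f g h : R) :
    'M[R]_(m * n) :=
  castmx (sum_ord_const m n, sum_ord_const m n)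
    (\mxblock_(i < m, j < m) block180 n a b c d e f g h i j).

(* Main.v *)
Require Import Defs.
From mathcomp Require Import all_boot all_order all_algebra.

(** Read a configuration row by row and split the update of row [k] into three
    one-dimensional three-point stencils, acting on the padded rows [k - 1],
    [k] and [k + 1] with weights [(a, b, c)], [(h, 0, d)] and [(g, f, e)].  On
    a padded row [z] that reflects on the left ([z 0 = z 2]) and vanishes on
    the right ([z n.+1 = 0]), a stencil with weights [(u, v, w)] is the
    tridiagonal matrix [v%:M + w P + u Q] corrected by [u] in position
    [(1, 2)], since the padding cell on the left repeats the second cell of the
    row ([stencil_mulmx]).  This yields the blocks [C3], [A3] and [B3].

    The rows [1, ..., m.+1] have such a padding, the last one being zero.  The
    padded row [0] is a copy of row [2], except that its right corner holds
    [y 2 n.-1] instead of [0]; so in the first block row the block [C3] acts on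
    row [2] with an extra [c] in position [(n, n.-1)], and it merges with [B3]
    into [D3] ([block180_mul]).

    Row-major flattening turns this identity between rows into
    [X' = blockmx180 *m X] ([successor180_mul]).  Conversely, every
    configuration has a successor ([successor180_ex]), so a rule matrix is
    determined by its action on all column vectors. *)

Set Implicit Arguments.
Unset Strict Implicit.
Unset Printing Implicit Defensive.

Import GRing.Theory.
Local Open Scope ring_scope.

(** * Three-point stencils on a padded row *)

Definition cell_col (R : Type) (n : nat) (z : nat -> R) : 'cV[R]_n :=
  \col_(j < n) z j.+1.

Definition stencil (R : pzRingType) (u v w : R) (z : nat -> R) (l : nat) : R :=
  u * z l.-1 + v * z l + w * z l.+1.

Section Stencil.

Context (R : pzRingType) (n : nat).
Implicit Types (u v w : R) (z : nat -> R).

Lemma Pmx_mul z :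
  z n.+1 = 0 -> Pmx R n *m cell_col n z = cell_col n (fun l => z l.+1).
Proof.
move=> z_right; apply/colP=> j; rewrite !mxE.
under eq_bigr => k _ do rewrite !mxE mulr_natl mulrb.
rewrite -big_mkcond (big_ord1_eq _ (fun k => z k.+1)).
case: ltnP => // n_le; have /eqP <- : n == j.+1 by rewrite eqn_leq n_le ltn_ord.
by rewrite z_right.
Qed.

Lemma munit_mul z r k : (0 < k <= n)%N ->
  munit R n r k *m cell_col n z = \col_(j < n) (z k *+ (j.+1 == r)).
Proof.
case: k => [|k] // /andP[_ lt_kn]; apply/colP=> j; rewrite !mxE.
under eq_bigr => i _ do rewrite !mxE eqSS mulr_natl.
case: eqP => _ /=; last by rewrite big1.
under eq_bigr => i _ do rewrite mulrb.
by rewrite -big_mkcond (big_ord1_eq _ (fun i => z i.+1)) lt_kn.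
Qed.

(** The subdiagonal reads the left neighbour of every cell but the first one,
    whose left neighbour is the padding cell, a copy of cell 2. *)
Lemma reflected_Qmx_mul z : (1 < n)%N -> z 0%N = z 2 ->
  (Qmx R n + munit R n 1 2) *m cell_col n z = cell_col n (fun l => z l.-1).
Proof.
move=> n_gt1 z_left; rewrite mulmxDl munit_mul //.
apply/colP=> -[[|j] lt_jn]; rewrite !mxE /=.
  by rewrite big1 ?add0r ?z_left // => k _; rewrite !mxE mul0r.
under eq_bigr => k _ do rewrite !mxE /= mulr_natl mulrb eqSS eq_sym.
rewrite -big_mkcond (big_ord1_eq _ (fun k => z k.+1)) addr0.
by rewrite (ltn_trans _ lt_jn).
Qed.

Lemma stencil_mulmx u v w z :
    (1 < n)%N -> z 0%N = z 2 -> z n.+1 = 0 ->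
  (v%:M + w *: Pmx R n + u *: Qmx R n + u *: munit R n 1 2) *m cell_col n z
    = cell_col n (stencil u v w z).
Proof.
move=> n_gt1 z_left z_right; rewrite -addrA -scalerDr !mulmxDl -!scalemxAl.
rewrite Pmx_mul // reflected_Qmx_mul // mul_scalar_mx.
by apply/colP=> j; rewrite !mxE /stencil addrC addrA.
Qed.

(** The extra matrix unit restores the contribution of the right padding cell,
    which is [0] in [z] and [z n.-1] in [z']. *)
Lemma stencil_mulmx_corner u v w z z' :
    (1 < n)%N -> z 0%N = z 2 -> z n.+1 = 0 ->
    {in [pred l | (l <= n)%N], z' =1 z} -> z' n.+1 = z n.-1 ->
  (v%:M + w *: Pmx R n + u *: Qmx R n + u *: munit R n 1 2
     + w *: munit R n n n.-1) *m cell_col n z = cell_col n (stencil u v w z').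
Proof.
move=> n_gt1 z_left z_right z'E z'_right.
rewrite mulmxDl stencil_mulmx // -scalemxAl munit_mul; last first.
  by rewrite leq_pred -subn1 subn_gt0 n_gt1.
apply/colP=> j; rewrite !mxE /stencil /=.
rewrite [z' j]z'E ?[z' j.+1]z'E ?inE ?(ltnW (ltn_ord j)) //.
rewrite -addrA -mulrDr; congr (_ + _ * _).
have [->|ne_jn] := eqVneq; first by rewrite z_right z'_right add0r.
by rewrite addr0 z'E // inE ltn_neqAle ne_jn ltn_ord.
Qed.

End Stencil.

Lemma moore_rule_stencil (R : pzRingType) (a b c d e f g h : R) y k l :
  moore_rule a b c d e f g h y k l =
  stencil a b c (y k.-1) l + stencil h 0 d (y k) l + stencil g f e (y k.+1) l.
Proof.
rewrite /moore_rule /stencil mul0r addr0.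
by rewrite [LHS](ACl ((1*2*3)*(8*4)*(7*6*5))).
Qed.

(** * Block rows *)

Section BlockRow.

Context (R : pzRingType) (m n : nat) (a b c d e f g h : R).

(** The sum over all blocks of a block row has at most three nonzero terms;
    [v m = 0] accounts for the missing right neighbour of the last row. *)
Lemma block180_sum (v : nat -> 'cV[R]_n) (i : 'I_m) : v m = 0 ->
  \sum_(k < m) block180 n a b c d e f g h i k *m v k =
    A3 n d h *m v i
    + (if i == 0 :> nat then D3 n a b c e f g *m v 1
       else C3 n a b c *m v i.-1 + B3 n e f g *m v i.+1).
Proof.
move=> vm0.
have pick (M : 'M[R]_n) s : (s <= m)%N ->
    \sum_(k < m) (if k == s :> nat then M *m v k else 0) = M *m v s.
  rewrite -big_mkcond (big_ord1_eq _ (fun k => M *m v k)) leq_eqVlt.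
  by case/predU1P=> [->|->//]; rewrite ltnn vm0 mulmx0.
case: i => [[|i] lt_im] /=.
  rewrite -(pick _ 0) // -(pick (D3 _ _ _ _ _ _ _) 1) // -big_split /=.
  apply: eq_bigr => -[[|[|k]] lt_km] _;
    by rewrite /block180 -val_eqE /= ?addr0 ?add0r ?mul0mx.
have lt_im' := ltnW lt_im.
rewrite -(pick _ i.+1) // -(pick _ i) ?(ltnW lt_im') // -(pick _ i.+2) //.
rewrite -!big_split /=; apply: eq_bigr => k _.
rewrite /block180 -val_eqE /= eq_sym eqSS [i == _]eq_sym.
have [->|_] := eqVneq (val k) i.+1.
  by rewrite !eqn_leq ltnn [(i.+2 <= _)%N]ltnn andbF !addr0.
have [->|_] := eqVneq (val k) i.
  by rewrite eqn_leq ltnNge leqnSn /= andbF addr0 add0r.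
by case: eqP; rewrite ?mul0mx !add0r.
Qed.

Lemma block180_mul (y : nat -> nat -> R) (i : 'I_m) :
    (1 < m)%N -> (1 < n)%N -> phi180 m n y ->
  \sum_(k < m) block180 n a b c d e f g h i k *m cell_col n (y k.+1) =
  cell_col n (moore_rule a b c d e f g h y i.+1).
Proof.
move=> m_gt1 n_gt1 [y_bot y_right y_left y_top y_tl y_tr].
(* Row [m.+1] is zero, hence it reflects on the left like the rows of the grid
   and [B3] may act on it. *)
have left k : (1 <= k <= m.+1)%N -> y k 0%N = y k 2.
  case/andP=> k_gt0; rewrite leq_eqVlt => /predU1P[->|lt_km].
    by rewrite !y_bot ?(leqW n_gt1).
  by apply: y_left; rewrite k_gt0.
rewrite (block180_sum (v := fun k => cell_col n (y k.+1))); last first.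
  by apply/colP=> j; rewrite !mxE y_bot // (leqW (ltn_ord j)).
have A3_mul k : (1 <= k <= m)%N ->
    A3 n d h *m cell_col n (y k) = cell_col n (stencil h 0 d (y k)).
  case/andP=> k1 km.
  rewrite -stencil_mulmx ?left ?y_right ?k1 ?(leqW km) //.
  by rewrite /A3 /Amx raddf0 add0r.
have C3_mul k : (1 <= k <= m)%N ->
    C3 n a b c *m cell_col n (y k) = cell_col n (stencil a b c (y k)).
  by case/andP=> k1 km; rewrite -stencil_mulmx ?left ?y_right ?k1 ?(leqW km).
have B3_mul k : (1 <= k <= m.+1)%N ->
    B3 n e f g *m cell_col n (y k) = cell_col n (stencil g f e (y k)).
  by move=> km; rewrite -stencil_mulmx ?left ?y_right.
case: i => [[|i] lt_im] /=.
  have -> : D3 n a b c e f g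
      = (C3 n a b c + c *: munit R n n n.-1) + B3 n e f g.
    by rewrite /D3 /C3 /B3 scalerDl addrA [LHS](ACl ((2*3*5)*(1*4))).
  rewrite A3_mul // mulmxDl B3_mul //.
  rewrite (@stencil_mulmx_corner _ _ _ _ _ _ (y 0%N)) ?(left 2) ?(y_right 2) //.
    by apply/colP=> j; rewrite !mxE moore_rule_stencil addrCA addrA.
  by case=> [|l] lt_ln; [rewrite y_tl left | rewrite y_top ?lt_ln].
rewrite A3_mul // C3_mul ?(ltnW lt_im) // B3_mul //.
by apply/colP=> j; rewrite !mxE moore_rule_stencil addrCA addrA.
Qed.

End BlockRow.

(** * Flattening *)

(** Both sides number the cells row by row: in the stacked rows, entry [j] of
    row [i] comes after [i] blocks of size [n]. *)
Lemma config_vec_mxcol (R : Type) (m n : nat) (x : 'M[R]_(m, n)) :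
  config_vec x =
  castmx (sum_ord_const m n, erefl) (\mxcol_(i < m) (row i x)^T).
Proof.
apply/colP=> k; case/mxvec_indexP: k => i j.
rewrite [LHS]mxE mxvecE [RHS]castmxE.
have -> : cast_ord (esym (sum_ord_const m n)) (mxvec_index i j)
    = @tagnat.Rank m (fun=> n) i j.
  apply: val_inj; rewrite [RHS]tagnat.RankEsum.
  rewrite -[in RHS](big_ord_widen m (fun=> n)) ?(ltnW (ltn_ord i)) //.
  by rewrite [in RHS]sum_ord_const -mxvec_index_val.
have /matrixP/(_ j 0) := mxcolK (fun i => (row i x)^T) i.
by rewrite !mxE => <-.
Qed.

Lemma successor180_mul (R : pzRingType) (m n : nat) (a b c d e f g h : R)
    (x x' : 'M[R]_(m, n)) :
    (1 < m)%N -> (1 < n)%N -> successor180 a b c d e f g h x x' ->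
  config_vec x' = blockmx180 m n a b c d e f g h *m config_vec x.
Proof.
move=> m_gt1 n_gt1 [y [y_pads y_phi x'E]]; rewrite !config_vec_mxcol.
have -> : \mxcol_(i < m) (row i x)^T = \mxcol_(i < m) cell_col n (y i.+1).
  by apply: eq_mxcol => i; apply/colP=> j; rewrite !mxE y_pads.
rewrite /blockmx180 (_ : _ *m _ = castmx (sum_ord_const m n, erefl)
  (\mxblock_(i < m, j < m) block180 n a b c d e f g h i j
     *m \mxcol_(i < m) cell_col n (y i.+1))).
  rewrite mul_mxblock_mxrow; congr castmx; apply: eq_mxcol => i.
  rewrite block180_mul //; apply/colP=> j.
  by rewrite !mxE x'E.
(* Generalizing the common dimension [m * n] makes the casts trivial. *)
by case: _ / (sum_ord_const m n).
Qed.

(** * Existence of successors *)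

Section Padding.

Context (R : pzRingType) (m n : nat) (x : 'M[R]_(m, n)).

Definition null_pad (k l : nat) : R :=
  if (k, l) isn't (k'.+1, l'.+1) then 0 else
  if (insub k' : option 'I_m, insub l' : option 'I_n) is (Some i, Some j)
  then x i j else 0.

Definition mirror (k : nat) : nat := if k is 0 then 2 else k.

(** The top right corner copies cell [(2, n.-1)], whereas reflecting its two
    coordinates separately would give [(2, n.+1)]. *)
Definition pad180 (k l : nat) : R :=
  null_pad (mirror k)
    (if (k == 0%N) && (l == n.+1) then n.-1 else mirror l).

Lemma null_pad_pads : pads x null_pad.
Proof. by move=> i j; rewrite /null_pad !valK. Qed.

Lemma null_pad_bottom l : null_pad m.+1 l = 0.
Proof. by rewrite /null_pad; case: l => // l; rewrite insubF ?ltnn. Qed.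

Lemma null_pad_right k : null_pad k n.+1 = 0.
Proof.
rewrite /null_pad; case: k => // k.
by rewrite [insub n]insubF ?ltnn //; case: insub.
Qed.

Lemma pad180_phi : (1 < n)%N -> phi180 m n pad180.
Proof.
rewrite /pad180; case: n null_pad_right => [|n'] // padr n_gt0; split=> /=.
- by move=> l _; rewrite null_pad_bottom.
- by case=> // k _; rewrite /= padr.
- by case.
- by case=> // l /andP[_ lt_ln]; rewrite eqSS ltn_eqF.
- by [].
- by rewrite eqxx; case: n' n_gt0 {padr}.
Qed.

End Padding.

Lemma successor180_ex (R : pzRingType) (m n : nat) (a b c d e f g h : R)
    (x : 'M[R]_(m, n)) : (1 < n)%N ->
  exists x', successor180 a b c d e f g h x x'.
Proof.
move=> n_gt1.
exists (\matrix_(i, j) moore_rule a b c d e f g h (pad180 x) i.+1 j.+1).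
exists (pad180 x); split; last by move=> i j; rewrite mxE.
- by move=> i j; rewrite /pad180 /= null_pad_pads.
- exact: pad180_phi.
Qed.

Theorem theorem3p4 (p m n : nat) (hp : prime p) (hm : (2 <= m)%N)
    (hn : (2 <= n)%N) (a b c d e f g h : 'F_p) (T : 'M['F_p]_(m * n)) :
  is_rule_matrix180 a b c d e f g h T <->
  T = blockmx180 m n a b c d e f g h.
Proof.
split=> [T_rule | -> x x']; last exact: successor180_mul.
suff T_mul (u : 'cV_(m * n)) : T *m u = blockmx180 m n a b c d e f g h *m u.
  apply/matrixP=> k l; move/colP/(_ k): (T_mul (delta_mx l 0)).
  by rewrite -!colE !mxE.
have -> : u = config_vec (vec_mx u^T) by rewrite /config_vec vec_mxK trmxK.
have [x' succ] := successor180_ex a b c d e f g h (vec_mx u^T) hn.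
by rewrite -(T_rule _ _ succ) (successor180_mul _ _ succ).
Qed.
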